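(* Let $k$ be a field and let $X$ be a finite set, with $k(X)$ the algebra of $k$-valued functions on $X$. Up to isomorphism, the generalised first order differential calculi $(\Omega^1,\mathrm{d})$ on $k(X)$ are in one-to-one correspondence with pairs $(\bar Q,R)$, where $\bar Q$ is a digraph on $X$ and $R=(R_{x,y})$ is an assignment $R_{x,y}\in\mathbb{N}_0$ for all $x,y\in X$ with $R_{x,y}\ge 1$ if $x\to y$ is an arrow in $\bar Q$. Here $\bar Q$ corresponds to the standard sub-calculus $(\bar\Omega^1,\mathrm{d})$ of $(\Omega^1,\mathrm{d})$.
   Context: $k$ is a field of characteristic not $2$, and $\mathbb{N}_0$ denotes the non-negative integers. A generalised first order differential calculus on an algebra $A$ is an $A$-$A$-bimodule $\Omega^1$ with a linear map $\mathrm{d}:A\to\Omega^1$ obeying the Leibniz rule $\mathrm{d}(ab)=(\mathrm{d}a)b+a\,\mathrm{d}b$ (it is not required that $\phi:A\otimes A\to\Omega^1$, $a\otimes b\mapsto a\,\mathrm{d}b$, be surjective). The standard sub-calculus is $\bar\Omega^1=\phi(A\otimes A)\subseteq\Omega^1$ with the same $\mathrm{d}$. An isomorphism $(\Omega^1,\mathrm{d})\to(\Omega^{1\prime},\mathrm{d}')$ of calculi on $A$ is an $A$-bimodule isomorphism $\psi$ with $\psi\circ\mathrm{d}=\mathrm{d}'$. A digraph on $X$ has vertex set $X$, no self-loops, and at most one arrow from $x$ to $y$ for each ordered pair $(x,y)$. The correspondence assigns to $(\Omega^1,\mathrm{d})$ the numbers $R_{x,y}=\dim_k(\delta_x\Omega^1\delta_y)$,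 and the digraph $\bar Q$ having an arrow $x\to y$ (for $x\ne y$) iff $\delta_x\,\mathrm{d}\delta_y\ne0$; here $\delta_x$ is the Kronecker delta function at $x$. The standard calculi on $k(X)$ (those with $\phi$ surjective) are the ones corresponding to digraphs on $X$.
   Formalization: The calculi are taken with Ω^1 finite dimensional over k, which is needed for R_{x,y} = dim(δ_x Ω^1 δ_y) to lie in N_0 (otherwise an infinite-dimensional Ω^1 with d = 0 is a counterexample); k may be any field, including characteristic 2. *)

(* Defs.v *)
From HB Require Import structures.
From mathcomp Require Import all_boot all_order all_algebra.

Set Implicit Arguments.
Unset Strict Implicit.
Unset Printing Implicit Defensive.

Import GRing.Theory.
Local Open Scope ring_scope.

(* The algebra k(X) with pointwise operations. The tag ^o only makes k a      *)
(* module over itself, so that k(X) is both a ring and a k-vector space; X    *)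
(* may be empty (k(X) is then the zero ring).                                 *)
Notation kfun k X := {ffun X -> k^o}.

Definition delta (k : fieldType) (X : finType) (x : X) : kfun k X :=
  [ffun y => (y == x)%:R].

(* A k(X)-k(X)-bimodule, finite dimensional over k (as forced by the numbers  *)
(* dim (delta_x M delta_y) being natural numbers), on which the two           *)
(* k-actions induced by k -> k(X) agree with the scaling of the vector space. *)
Record bimodule (k : fieldType) (X : finType) := Bimodule {
  bimod_sort :> vectType k;
  lact : kfun k X -> bimod_sort -> bimod_sort;
  ract : bimod_sort -> kfun k X -> bimod_sort;
  lact_linear : forall a, linear (lact a);
  lact_linearl : forall v, linear (fun a => lact a v);
  ract_linear : forall a, linear (fun v => ract v a);
  ract_linearr : forall v, linear (ract v);
  lact1 : forall v, lact 1 v = v;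
  lactM : forall a b v, lact (a * b) v = lact a (lact b v);
  ract1 : forall v, ract v 1 = v;
  ractM : forall a b v, ract v (a * b) = ract (ract v a) b;
  lractA : forall a v b, ract (lact a v) b = lact a (ract v b)
}.
Arguments lact {k X} {_} _ _.
Arguments ract {k X} {_} _ _.

Record calculus (k : fieldType) (X : finType) := Calculus {
  calc_bimod :> bimodule k X;
  diff : kfun k X -> calc_bimod;
  diff_linear : linear diff;
  diff_Leibniz : forall a b, diff (a * b) = ract (diff a) b + lact a (diff b)
}.
Arguments diff {k X}.

Definition calc_iso (k : fieldType) (X : finType) (C D : calculus k X) : Prop :=
  exists psi : C -> D,
    [/\ linear psi /\ bijective psi,
        forall a v, psi (lact a v) = lact a (psi v),
        forall v a, psi (ract v a) = ract (psi v) a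
      & forall a, psi (diff C a) = diff D a].

(* Surjectivity of phi : a (x) b |-> a db; elements of the tensor product are *)
(* finite sums of pure tensors.                                               *)
Definition is_standard (k : fieldType) (X : finType) (C : calculus k X) : Prop :=
  forall v : C, exists s : seq (kfun k X * kfun k X),
    v = \sum_(p <- s) lact p.1 (diff C p.2).

Section Actions.
Variables (k : fieldType) (X : finType).
Implicit Types (M : bimodule k X) (C : calculus k X).

HB.instance Definition _ M a := GRing.isLinear.Build k M M _ (@lact k X M a)
  (lact_linear a).
HB.instance Definition _ M v := GRing.isLinear.Build k (kfun k X) M _
  (@ract k X M v) (ract_linearr v).
HB.instance Definition _ C := GRing.isLinear.Build k (kfun k X) C _ (diff C)
  (@diff_linear k X C).

Definition lactr M (v : M) (a : kfun k X) : M := lact a v.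
HB.instance Definition _ M v := GRing.isLinear.Build k (kfun k X) M _ (@lactr M v)
  (lact_linearl v).
Definition ractl M (a : kfun k X) (v : M) : M := ract v a.
HB.instance Definition _ M a := GRing.isLinear.Build k M M _ (@ractl M a)
  (ract_linear a).

Definition corner_map M (x y : X) (v : M) : M := lact (delta k x) (ract v (delta k y)).

Lemma corner_map_linear M x y : linear (@corner_map M x y).
Proof.
by move=> c u v; rewrite /corner_map ract_linear linearP.
Qed.
HB.instance Definition _ M x y := GRing.isLinear.Build k M M _ (@corner_map M x y)
  (@corner_map_linear M x y).

(* The subspace delta_x M delta_y. *)
Definition corner M (x y : X) : {vspace M} := (linfun (@corner_map M x y) @: fullv)%VS.

Lemma mem_cornerP M x y (v : M) :
  reflect (exists u : M, v = lact (delta k x) (ract u (delta k y))) (v \in corner M x y).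
Proof.
apply: (iffP memv_imgP) => [[u _ ->]|[u ->]]; exists u; rewrite ?lfunE ?memvf //.
Qed.

Lemma kfun_decomp (a : kfun k X) : a = \sum_x a x *: delta k x.
Proof.
apply/ffunP => y; rewrite sum_ffunE (bigD1 y) //= big1 => [|x nxy].
  by rewrite !ffunE eqxx addr0 [LHS](esym (mulr1 _)).
by rewrite !ffunE eq_sym (negPf nxy) scaler0.
Qed.

(* phi(k(X) (x) k(X)), spanned by the images of the basis                     *)
(* delta_x (x) delta_y; see mem_std_spaceP.                                   *)
Definition std_space C : {vspace C} :=
  <<[seq lact (delta k x) (diff C (delta k y)) | x <- enum X, y <- enum X]>>%VS.

Lemma mem_std_space C a b : lact a (diff C b) \in std_space C.
Proof.
rewrite (kfun_decomp b) !linear_sum memv_suml // => y _.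
rewrite !linearZ memvZ //= (kfun_decomp a) -/(lactr _ _) linear_sum memv_suml // => x _.
rewrite linearZ memvZ // memv_span //.
by apply/allpairsP; exists (x, y); rewrite !mem_enum.
Qed.

Lemma mem_std_spaceP C (v : C) :
  v \in std_space C <->
  exists s : seq (kfun k X * kfun k X), v = \sum_(p <- s) lact p.1 (diff C p.2).
Proof.
split=> [vC|[s ->]]; last first.
  by apply: memv_suml => p _; apply: mem_std_space.
pose t := [seq lact (delta k x) (diff C (delta k y)) | x <- enum X, y <- enum X].
rewrite (@coord_span _ _ _ (in_tuple t) v vC).
have ht i : exists p : kfun k X * kfun k X, (in_tuple t)`_i = lact p.1 (diff C p.2).
  case: (ltnP i (size t)) => [/(mem_nth 0)/allpairsP[[x y] [_ _ e]]|le].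
    by exists (delta k x, delta k y).
  by exists (0, 0); rewrite nth_default //= [diff C _]linear0 linear0.
elim/big_ind: _ => [|u v' [s ->] [s' ->]|i _].
- by exists [::]; rewrite big_nil.
- by exists (s ++ s'); rewrite big_cat.
have [p ->] := ht i; exists [:: (coord (in_tuple t) i v *: p.1, p.2)].
by rewrite big_seq1 /= -[RHS]/(lactr _ _) linearZ.
Qed.

Lemma std_space_lact C a v : v \in std_space C -> lact a v \in std_space C.
Proof.
move=> /mem_std_spaceP[s ->]; rewrite linear_sum memv_suml // => p _ /=.
by rewrite -lactM mem_std_space.
Qed.

Lemma std_space_ract C a v : v \in std_space C -> ract v a \in std_space C.
Proof.
move=> /mem_std_spaceP[s ->]; rewrite -/(ractl _ _) linear_sum memv_suml // => p _.
rewrite /= /ractl lractA.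
have -> : ract (diff C p.2) a = diff C (p.2 * a) - lact p.2 (diff C a).
  by rewrite diff_Leibniz addrK.
rewrite linearB; apply: memvB; first exact: mem_std_space.
by rewrite /= -lactM; apply: mem_std_space.
Qed.

Lemma std_space_diff C a : diff C a \in std_space C.
Proof. by rewrite -[diff C a]lact1 mem_std_space. Qed.

End Actions.

Section StandardSubcalculus.
Variables (k : fieldType) (X : finType) (C : calculus k X).
Local Notation U := (subvs_of (std_space C)).

Definition std_lact (a : kfun k X) (v : U) : U := Subvs (std_space_lact a (subvsP v)).
Definition std_ract (v : U) (a : kfun k X) : U := Subvs (std_space_ract a (subvsP v)).
Definition std_diff (a : kfun k X) : U := Subvs (std_space_diff C a).

Fact std_lact_linear a : linear (std_lact a).
Proof. by move=> c u v; apply: val_inj; rewrite /= !lact_linear. Qed.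
Fact std_lact_linearl v : linear (fun a => std_lact a v).
Proof. by move=> c a b; apply: val_inj; rewrite /= !lact_linearl. Qed.
Fact std_ract_linear a : linear (fun v => std_ract v a).
Proof. by move=> c u v; apply: val_inj; rewrite /= !ract_linear. Qed.
Fact std_ract_linearr v : linear (std_ract v).
Proof. by move=> c a b; apply: val_inj; rewrite /= !ract_linearr. Qed.
Fact std_lact1 v : std_lact 1 v = v.
Proof. by apply: val_inj; rewrite /= lact1. Qed.
Fact std_lactM a b v : std_lact (a * b) v = std_lact a (std_lact b v).
Proof. by apply: val_inj; rewrite /= lactM. Qed.
Fact std_ract1 v : std_ract v 1 = v.
Proof. by apply: val_inj; rewrite /= ract1. Qed.
Fact std_ractM a b v : std_ract v (a * b) = std_ract (std_ract v a) b.
Proof. by apply: val_inj; rewrite /= ractM. Qed.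
Fact std_lractA a v b : std_ract (std_lact a v) b = std_lact a (std_ract v b).
Proof. by apply: val_inj; rewrite /= lractA. Qed.

Definition std_bimodule : bimodule k X :=
  Bimodule std_lact_linear std_lact_linearl std_ract_linear std_ract_linearr
    std_lact1 std_lactM std_ract1 std_ractM std_lractA.

Fact std_diff_linear : linear (std_diff : _ -> std_bimodule).
Proof. by move=> c a b; apply: val_inj; rewrite /= diff_linear. Qed.
Fact std_diff_Leibniz a b :
  std_diff (a * b) = ract (std_diff a : std_bimodule) b + lact a (std_diff b : std_bimodule).
Proof. by apply: val_inj; rewrite /= diff_Leibniz. Qed.

Definition std_subcalculus : calculus k X :=
  @Calculus k X std_bimodule std_diff std_diff_linear std_diff_Leibniz.

End StandardSubcalculus.

(* There is at most one arrow per ordered pair since arrows form a set. *)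
Record digraph (X : finType) := Digraph {
  arrows :> {set X * X};
  arrows_irrefl : [forall x, (x, x) \notin arrows]
}.

(* The standard calculus attached to a digraph: the vector space on the       *)
(* arrows, here as functions w on arrows, with a . (x->y) = a(x) (x->y),      *)
(* (x->y) . b = b(y) (x->y) and da = sum_(x->y) (a(y) - a(x)) (x->y).         *)
Section DigraphCalculus.
Variables (k : fieldType) (X : finType) (Q : digraph X).
Local Notation E := {p : X * X | p \in arrows Q}.
Local Notation W := {ffun E -> k^o}.

Definition arr_lact (a : kfun k X) (w : W) : W := [ffun e => a (val e).1 * w e].
Definition arr_ract (w : W) (b : kfun k X) : W := [ffun e => w e * b (val e).2].
Definition arr_diff (a : kfun k X) : W := [ffun e => a (val e).2 - a (val e).1].

Fact arr_lact_linear a : linear (arr_lact a).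
Proof. by move=> c u v; apply/ffunP=> e; rewrite !ffunE mulrDr -scalerAr. Qed.
Fact arr_lact_linearl v : linear (fun a => arr_lact a v).
Proof. by move=> c a b; apply/ffunP=> e; rewrite !ffunE mulrDl -scalerAl. Qed.
Fact arr_ract_linear a : linear (fun v => arr_ract v a).
Proof. by move=> c u v; apply/ffunP=> e; rewrite !ffunE mulrDl -scalerAl. Qed.
Fact arr_ract_linearr v : linear (arr_ract v).
Proof. by move=> c a b; apply/ffunP=> e; rewrite !ffunE mulrDr -scalerAr. Qed.
Fact arr_lact1 v : arr_lact 1 v = v.
Proof. by apply/ffunP=> e; rewrite !ffunE mul1r. Qed.
Fact arr_lactM a b v : arr_lact (a * b) v = arr_lact a (arr_lact b v).
Proof. by apply/ffunP=> e; rewrite !ffunE mulrA. Qed.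
Fact arr_ract1 v : arr_ract v 1 = v.
Proof. by apply/ffunP=> e; rewrite !ffunE mulr1. Qed.
Fact arr_ractM a b v : arr_ract v (a * b) = arr_ract (arr_ract v a) b.
Proof. by apply/ffunP=> e; rewrite !ffunE mulrA. Qed.
Fact arr_lractA a v b : arr_ract (arr_lact a v) b = arr_lact a (arr_ract v b).
Proof. by apply/ffunP=> e; rewrite !ffunE mulrA. Qed.

Definition arr_bimodule : bimodule k X :=
  Bimodule arr_lact_linear arr_lact_linearl arr_ract_linear arr_ract_linearr
    arr_lact1 arr_lactM arr_ract1 arr_ractM arr_lractA.

Fact arr_diff_linear : linear (arr_diff : _ -> arr_bimodule).
Proof.
by move=> c a b; apply/ffunP=> e; rewrite !ffunE scalerBr opprD addrACA.
Qed.
Fact arr_diff_Leibniz a b :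
  arr_diff (a * b) = ract (arr_diff a : arr_bimodule) b + lact a (arr_diff b : arr_bimodule).
Proof.
by apply/ffunP=> e; rewrite !ffunE mulrBl mulrBr addrA subrK.
Qed.

Definition digraph_calculus : calculus k X :=
  @Calculus k X arr_bimodule arr_diff arr_diff_linear arr_diff_Leibniz.

End DigraphCalculus.
Arguments digraph_calculus k {X} Q.

Section Correspondence.
Variables (k : fieldType) (X : finType).
Implicit Types C : calculus k X.

Definition calc_arrows C : {set X * X} :=
  [set p | (p.1 != p.2) && (lact (delta k p.1) (diff C (delta k p.2)) != 0)].

Fact calc_arrows_irrefl C : [forall x, (x, x) \notin calc_arrows C].
Proof. by apply/forallP => x; rewrite inE /= eqxx. Qed.

Definition calc_digraph C : digraph X := Digraph (calc_arrows_irrefl C).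

Definition calc_dims C : {ffun X * X -> nat} := [ffun p => \dim (corner C p.1 p.2)].

Definition calc_data C : digraph X * {ffun X * X -> nat} :=
  (calc_digraph C, calc_dims C).

End Correspondence.

Definition admissible (X : finType) (D : digraph X * {ffun X * X -> nat}) : Prop :=
  forall x y : X, (x, y) \in arrows D.1 -> (1 <= D.2 (x, y))%N.

(* Main.v *)
Require Import Defs.
From HB Require Import structures.
From mathcomp Require Import all_boot all_order all_algebra.

(** Since [k(X)] is spanned by orthogonal idempotents, a bimodule is the direct
    sum of its corners [delta_x M delta_y], on which [a] acts by the scalars
    [a x] and [a y].  Writing [w_xy] for the corner components of [d delta_y],
    the Leibniz rule gives that the [(x, y)]-component of [d a] is
    [(a y - a x) w_xy].  A calculus is therefore a family of vector spaces with
    one marked vector in each off-diagonal one, and pairs (space, vector) are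
    classified by the dimension and by whether the vector vanishes. *)

Set Implicit Arguments.
Unset Strict Implicit.
Unset Printing Implicit Defensive.

Import GRing.Theory.
Local Open Scope ring_scope.

(** * Bases adapted to a marked vector of a subspace *)

Section PointedSubspaces.
Variable k : fieldType.

(** A non-zero [u] is prepended to a basis of a complement of its line in [U]. The guard [u != 0]
    lets the same statement cover [u = 0], where any basis will do. *)
Lemma basis_extending (V : vectType k) (U : {vspace V}) (u : V) :
  u \in U -> exists2 b : seq V, basis_of U b & u != 0 -> head 0 b = u.
Proof.
move=> uU; have [->|u0] := eqVneq u 0; first by exists (vbasis U); first exact: vbasisP.
exists (u :: vbasis (U :\: <[u]>)%VS) => //=.
have e : (<[u]> + (U :\: <[u]>) = U)%VS by rewrite addvC addv_diff; apply/addv_idPl.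
rewrite -[X in basis_of X]e; apply: (@cat_basis _ _ _ _ [:: u]).
- by apply/directv_addP; rewrite capvC capv_diff.
- exact: seq1_basis.
- exact: vbasisP.
Qed.

(** Two bases of equal size that start with the marked vectors are matched entry by entry. The maps
    live on the ambient spaces and are required to be mutually inverse only on the subspaces, so no
    subspace types enter. *)
Lemma pointed_subspace_iso (V V' : vectType k) (U : {vspace V}) (U' : {vspace V'}) u u' :
    u \in U -> u' \in U' -> \dim U = \dim U' -> (u == 0) = (u' == 0) ->
  exists f : 'Hom(V, V') * 'Hom(V', V),
    [/\ f.1 u = u',
        {in U, forall v, f.1 v \in U'}, {in U', forall v, f.2 v \in U},
        {in U, cancel f.1 f.2} & {in U', cancel f.2 f.1}].
Proof.
move=> uU u'U' dUU' uu'.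
have [b bU hb] := basis_extending uU; have [b' bU' hb'] := basis_extending u'U'.
have sb : size b = size b'.
  by rewrite -(size_basis (X := in_tuple b) bU) -(size_basis (X := in_tuple b') bU').
have [f fb] := linear_of_free b b'; have [g gb] := linear_of_free b' b.
have {}fb : map (linfun f) b = b'.
  by rewrite -[RHS]fb ?(basis_free bU) ?sb //; apply/eq_map => v; rewrite lfunE.
have {}gb : map (linfun g) b' = b.
  by rewrite -[RHS]gb ?(basis_free bU') ?sb //; apply/eq_map => v; rewrite lfunE.
exists (linfun f, linfun g); split=> /=.
- have [u0|u0] := eqVneq u 0.
    by move: uu'; rewrite u0 eqxx linear0 => /esym/eqP->.
  have u'0 : u' != 0 by rewrite -uu'.
  rewrite -(hb u0) -(hb' u'0) -fb.
  (* An empty [b] has default head [0], which [u != 0] excludes. *)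
  by case: (b) (hb u0) => //= e; rewrite -e eqxx in u0.
- move=> v vU; rewrite -(span_basis bU') -fb -limg_span (span_basis bU).
  exact: memv_img.
- move=> v vU; rewrite -(span_basis bU) -gb -limg_span (span_basis bU').
  exact: memv_img.
- move=> v; rewrite -(span_basis bU) => /(@coord_span _ _ _ (in_tuple b))->.
  rewrite !linear_sum; apply: eq_bigr => i _; rewrite !linearZ /=; congr (_ *: _).
  have ib' : (i < size b')%N by rewrite -sb ltn_ord.
  by rewrite -(nth_map 0 0) ?fb -?(nth_map 0 0) ?gb.
- move=> v; rewrite -(span_basis bU') => /(@coord_span _ _ _ (in_tuple b'))->.
  rewrite !linear_sum; apply: eq_bigr => i _; rewrite !linearZ /=; congr (_ *: _).
  have ib : (i < size b)%N by rewrite sb ltn_ord.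
  by rewrite -(nth_map 0 0) ?gb -?(nth_map 0 0) ?fb.
Qed.

End PointedSubspaces.

(** * Decomposition of a bimodule into its corners *)

Section Corners.
Variables (k : fieldType) (X : finType).

Lemma delta_mul x (a : kfun k X) : delta k x * a = a x *: delta k x.
Proof.
apply/ffunP => z; rewrite !ffunE; have [->|_] := eqVneq z x.
  by rewrite mul1r [RHS]mulr1.
by rewrite mul0r [RHS]mulr0.
Qed.

Lemma mul_delta x (a : kfun k X) : a * delta k x = a x *: delta k x.
Proof. by rewrite -delta_mul; apply/ffunP => z; rewrite !ffunE mulrC. Qed.

Lemma sum_delta : \sum_(x : X) delta k x = 1.
Proof.
rewrite [RHS]kfun_decomp; apply: eq_bigr => x _.
by rewrite ffunE scale1r.
Qed.

Variable M : bimodule k X.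
Implicit Types (u v w : M) (a b : kfun k X) (x y : X).

Lemma lactZl c a v : lact (c *: a) v = c *: lact a v.
Proof. exact: (linearZ_LR (lactr v)). Qed.

Lemma corner_map_corner x y v : corner_map x y v \in corner M x y.
Proof. by apply/mem_cornerP; exists v. Qed.

Lemma lact_corner a x y v : v \in corner M x y -> lact a v = a x *: v.
Proof.
by move=> /mem_cornerP[u ->]; rewrite -lactM mul_delta lactZl.
Qed.

Lemma ract_corner a x y v : v \in corner M x y -> ract v a = a y *: v.
Proof.
move=> /mem_cornerP[u ->].
by rewrite lractA -ractM delta_mul !linearZ.
Qed.

(** On a corner the delta functions act by 0 or 1, so the corner maps are mutually orthogonal
    projections. *)
Lemma corner_map_id x y x' y' v : v \in corner M x y ->
  corner_map x' y' v = ((x' == x) && (y' == y))%:R *: v.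
Proof.
move=> vxy; rewrite /corner_map (ract_corner _ vxy) linearZ /= (lact_corner _ vxy).
rewrite !ffunE scalerA [x == _]eq_sym [y == _]eq_sym.
by case: (x' == x); case: (y' == y); rewrite /= ?(mulr0, mul0r, mulr1).
Qed.

(** Insert [1 = \sum_x delta k x] on both sides of [v]. *)
Lemma sum_corner_map v : \sum_(p : X * X) corner_map p.1 p.2 v = v.
Proof.
transitivity (\sum_x \sum_y corner_map x y v); first by rewrite pair_bigA.
transitivity (\sum_x lact (delta k x) v).
  apply: eq_bigr => x _; rewrite -(linear_sum (lact _)) -(linear_sum (ract v)).
  by rewrite sum_delta /= ract1.
by rewrite -(linear_sum (lactr v)) sum_delta; apply: lact1.
Qed.

(** The sum of the corners is direct. This reads off the components of a map that is glued corner by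
    corner. *)
Lemma corner_map_sum (F : X * X -> M) p :
    (forall q, F q \in corner M q.1 q.2) ->
  corner_map p.1 p.2 (\sum_q F q) = F p.
Proof.
move=> FM; rewrite linear_sum (bigD1 p) //= big1 => [|q qp].
  by rewrite (corner_map_id _ _ (FM p)) !eqxx scale1r addr0.
rewrite (corner_map_id _ _ (FM q)) -xpair_eqE -!surjective_pairing eq_sym.
by rewrite (negPf qp) scale0r.
Qed.

Lemma corner_map_lact a x y v : corner_map x y (lact a v) = a x *: corner_map x y v.
Proof. by rewrite /corner_map lractA -lactM delta_mul lactZl. Qed.

Lemma corner_map_ract a x y v : corner_map x y (ract v a) = a y *: corner_map x y v.
Proof. by rewrite /corner_map -ractM mul_delta !linearZ. Qed.

End Corners.

(** * Components of the differential *)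

Section Arrows.
Variables (k : fieldType) (X : finType).
Implicit Types (C D : calculus k X) (x y : X).

(** The marked vector of a corner. Cutting on both sides keeps it in the corner and makes it vanish
    on the diagonal, so that its non-vanishing is exactly the presence of an arrow. *)
Definition arrow_form C x y : C := corner_map x y (diff C (delta k y)).

(** Since [a * delta k y = a y *: delta k y], the Leibniz rule expresses
    [ract (diff C a) (delta k y)] through [diff C (delta k y)]; left multiplication by [delta k x]
    then turns [a] into the scalar [a x]. *)
Lemma corner_map_diff C x y (a : kfun k X) :
  corner_map x y (diff C a) = (a y - a x) *: lact (delta k x) (diff C (delta k y)).
Proof.
have e : ract (diff C a) (delta k y) = a y *: diff C (delta k y) - lact a (diff C (delta k y)).
  by rewrite -linearZ -mul_delta /= diff_Leibniz addrK.
by rewrite /corner_map e linearB linearZ /= -lactM delta_mul lactZl scalerBl.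
Qed.

Lemma arrow_formE C x y :
  arrow_form C x y = if x == y then 0 else lact (delta k x) (diff C (delta k y)).
Proof.
rewrite /arrow_form corner_map_diff !ffunE eqxx; case: eqVneq => _.
  by rewrite subrr scale0r.
by rewrite subr0 scale1r.
Qed.

Lemma corner_diff C x y (a : kfun k X) :
  corner_map x y (diff C a) = (a y - a x) *: arrow_form C x y.
Proof.
rewrite corner_map_diff arrow_formE; case: eqVneq => // ->.
by rewrite subrr !scale0r.
Qed.

Lemma mem_calc_arrows C x y : ((x, y) \in calc_arrows C) = (arrow_form C x y != 0).
Proof. by rewrite inE arrow_formE /=; case: eqVneq; rewrite ?eqxx. Qed.

(** * The data as a complete isomorphism invariant *)

Lemma calc_data_admissible C : admissible (calc_data C).
Proof.
move=> x y; rewrite mem_calc_arrows ffunE /= lt0n dimv_eq0.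
apply: contra => /eqP c0; rewrite -memv0 -c0; exact: corner_map_corner.
Qed.

Lemma digraph_inj (Q Q' : digraph X) : arrows Q = arrows Q' -> Q = Q'.
Proof.
by case: Q Q' => [A hA] [B hB] /= e; rewrite e in hA *; rewrite (bool_irrelevance hA hB).
Qed.

Lemma calc_data_inj C D :
    (forall x y, (arrow_form C x y == 0) = (arrow_form D x y == 0)) ->
    (forall x y, \dim (corner C x y) = \dim (corner D x y)) ->
  calc_data C = calc_data D.
Proof.
move=> hA hd; congr pair; last by apply/ffunP => -[x y]; rewrite !ffunE hd.
by apply: digraph_inj; apply/setP => -[x y]; rewrite !mem_calc_arrows hA.
Qed.

(** A bimodule map commutes with the corner maps, so [psi] carries corners onto corners and arrow
    forms to arrow forms; injectivity preserves dimensions and non-vanishing. *)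
Lemma calc_iso_data C D : calc_iso C D -> calc_data C = calc_data D.
Proof.
case=> psi [[lin [phi psiK phiK]] psil psir psid].
pose lin' := GRing.isLinear.Build k C D _ psi lin.
pose L : {linear C -> D} := HB.pack psi lin'.
have LK : lker (linfun L) = 0%VS.
  by apply/eqP/lker0P; apply: (can_inj (g := phi)) => v; rewrite lfunE /= psiK.
have Lc x y v : L (corner_map x y v) = corner_map x y (L v).
  by rewrite /corner_map /= psil psir.
apply: calc_data_inj => x y.
  rewrite /arrow_form -psid -(Lc x y) /= -[LHS](inj_eq (can_inj psiK)).
  by rewrite -[psi 0]/(L 0) linear0.
rewrite -(limg_dim_eq (f := linfun L)) ?LK ?capv0 //; congr (\dim _).
apply/vspaceP => w; apply/memv_imgP/mem_cornerP => [[_ /mem_cornerP[u ->] ->]|[u ->]].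
  by exists (L u); rewrite lfunE; apply: Lc.
exists (corner_map x y (phi u)); first exact: corner_map_corner.
by rewrite lfunE /= -[psi _]/(L _) Lc /= phiK.
Qed.

Lemma calc_data_iso C D : calc_data C = calc_data D -> calc_iso C D.
Proof.
case=> eA /ffunP ed.
have hA x y : (arrow_form C x y == 0) = (arrow_form D x y == 0).
  by apply: negb_inj; rewrite -!mem_calc_arrows eA.
have hf (p : X * X) : exists f : 'Hom(C, D) * 'Hom(D, C),
    [/\ f.1 (arrow_form C p.1 p.2) = arrow_form D p.1 p.2,
        {in corner C p.1 p.2, forall v, f.1 v \in corner D p.1 p.2},
        {in corner D p.1 p.2, forall v, f.2 v \in corner C p.1 p.2},
        {in corner C p.1 p.2, cancel f.1 f.2} & {in corner D p.1 p.2, cancel f.2 f.1}].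
  apply: pointed_subspace_iso; [exact: corner_map_corner | exact: corner_map_corner | |].
    by have := ed p; rewrite !ffunE.
  exact: hA.
have [f {}hf] := fin_all_exists hf.
pose psi v := \sum_p (f p).1 (corner_map p.1 p.2 v).
pose phi w := \sum_p (f p).2 (corner_map p.1 p.2 w).
(* [psi] and [phi] are block diagonal, so everything below can be checked in one corner at a
   time. *)
have psi_corner p v : corner_map p.1 p.2 (psi v) = (f p).1 (corner_map p.1 p.2 v).
  apply: (corner_map_sum (F := fun q => (f q).1 _)) => q.
  by have [_ h _ _ _] := hf q; apply/h/corner_map_corner.
have phi_corner p w : corner_map p.1 p.2 (phi w) = (f p).2 (corner_map p.1 p.2 w).
  apply: (corner_map_sum (F := fun q => (f q).2 _)) => q.
  by have [_ _ h _ _] := hf q; apply/h/corner_map_corner.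
exists psi; split.
- split.
    move=> c u v; rewrite /psi scaler_sumr -big_split.
    by apply: eq_bigr => p _; rewrite !linearP.
  exists phi => v; rewrite -[RHS]sum_corner_map; apply: eq_bigr => p _.
    by rewrite psi_corner; have [_ _ _ -> //] := hf p; apply: corner_map_corner.
  by rewrite phi_corner; have [_ _ _ _ -> //] := hf p; apply: corner_map_corner.
- move=> a v; rewrite -[RHS]sum_corner_map; apply: eq_bigr => p _.
  by rewrite !corner_map_lact linearZ psi_corner.
- move=> v a; rewrite -[RHS]sum_corner_map; apply: eq_bigr => p _.
  by rewrite !corner_map_ract linearZ psi_corner.
- move=> a; rewrite -[RHS]sum_corner_map; apply: eq_bigr => p _.
  (* Each component of [diff C a] is a multiple of the arrow form by a scalar that depends only on
     [a], so matching arrow forms suffices. *)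
  by rewrite !corner_diff linearZ /=; have [-> _ _ _ _] := hf p.
Qed.

(** * Standard calculi and digraphs *)

(** Every component of [a db] is a multiple of the arrow form, so the corner of a standard calculus
    is the line, possibly zero, spanned by it. *)
Lemma standard_dim C x y :
  is_standard C -> \dim (corner C x y) = (arrow_form C x y != 0).
Proof.
move=> Cstd; rewrite -dim_vline; congr (\dim _); apply: subv_anti.
apply/andP; split; last by rewrite -memvE corner_map_corner.
apply/subvP => _ /mem_cornerP[v ->]; have [s ->] := Cstd v.
rewrite -[lact _ _]/(corner_map x y _) linear_sum memv_suml // => p _ /=.
by rewrite corner_map_lact corner_diff !memvZ // memv_line.
Qed.

Lemma standard_data_inj C D : is_standard C -> is_standard D ->
  calc_digraph C = calc_digraph D -> calc_data C = calc_data D.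
Proof.
move=> hC hD [eA].
have hA x y : (arrow_form C x y == 0) = (arrow_form D x y == 0).
  by apply: negb_inj; rewrite -!mem_calc_arrows eA.
by apply: calc_data_inj => // x y; rewrite !standard_dim ?hA.
Qed.

Lemma std_subcalculus_standard C : is_standard (std_subcalculus C).
Proof.
move=> v; have [s es] := (mem_std_spaceP (vsval v)).1 (subvsP v).
by exists s; apply: val_inj; rewrite [LHS]es [RHS](linear_sum vsval).
Qed.

Lemma std_subcalculus_digraph C : calc_digraph (std_subcalculus C) = calc_digraph C.
Proof. by apply: digraph_inj; apply/setP => -[x y]; rewrite !inE. Qed.

Lemma arrow_neq (Q : digraph X) (p : X * X) : p \in arrows Q -> p.1 != p.2.
Proof.
case: p => x y; apply: contraTneq => /= ->.
exact: (forallP (arrows_irrefl Q)).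
Qed.

(** For an arrow [e] from x to y, [delta_x d(delta_y)] is the indicator function of [e], because x
    and y differ; expanding [w] over the arrows gives the required sum. *)
Lemma digraph_calculus_standard (Q : digraph X) : is_standard (digraph_calculus k Q).
Proof.
move=> w; pose E := {p | p \in arrows Q}.
exists [seq (w e *: delta k (val e).1, delta k (val e).2) | e <- enum [set: E]].
rewrite big_map big_enum /=; apply/ffunP => e.
rewrite sum_ffunE (bigD1 e) ?inE //= big1 => [|e' /andP[_ ne]]; rewrite !ffunE.
  rewrite !eqxx (negPf (arrow_neq (valP e))) subr0 addr0 mulr1.
  exact/esym/mulr1.
have [h1|_] := eqVneq (val e).1 (val e').1; last by rewrite [_ *: _]mulr0 mul0r.
have [h2|_] := eqVneq (val e).2 (val e').2.
  by case/eqP: ne; apply: val_inj; apply/eqP; rewrite -pair_eqE /pair_eq h1 h2 !eqxx.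
by rewrite h1 (negPf (arrow_neq (valP e'))) subrr mulr0.
Qed.

Lemma digraph_calculus_digraph (Q : digraph X) : calc_digraph (digraph_calculus k Q) = Q.
Proof.
apply: digraph_inj; apply/setP => -[x y]; rewrite !inE /=.
apply/andP/idP => [[xy]|xyQ].
  apply: contraR => xyQ; apply/eqP/ffunP => e; rewrite !ffunE.
  have [h1|_] := eqVneq (val e).1 x; last by rewrite mul0r.
  have [h2|_] := eqVneq (val e).2 y; last by rewrite h1 (negPf xy) subrr mulr0.
  by case/negP: xyQ; case: e h1 h2 => -[x' y'] /= h <- <-.
have /= xy := arrow_neq xyQ; split=> //.
apply/eqP => /ffunP/(_ (exist _ (x, y) xyQ)); rewrite !ffunE /= !eqxx (negPf xy).
by rewrite mul1r subr0 => /eqP; rewrite oner_eq0.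
Qed.

End Arrows.

(** [k^(R x y)] as the [(x, y)]-corner, with the first basis vector marked when
    [x -> y] is an arrow. *)
Section Model.
Variables (k : fieldType) (X : finType) (D : digraph X * {ffun X * X -> nat}).
Local Notation I := {p : X * X & 'I_(D.2 p)}.
Local Notation W := {ffun I -> k^o}.

Definition model_lact (a : kfun k X) (w : W) : W := [ffun i => a (tag i).1 * w i].
Definition model_ract (w : W) (b : kfun k X) : W := [ffun i => w i * b (tag i).2].
Definition model_diff (a : kfun k X) : W :=
  [ffun i : I => ((tag i \in arrows D.1) && (val (tagged i) == 0%N))%:R
             * (a (tag i).2 - a (tag i).1)].

Fact model_lact_linear a : linear (model_lact a).
Proof. by move=> c u v; apply/ffunP=> i; rewrite !ffunE mulrDr -scalerAr. Qed.
Fact model_lact_linearl v : linear (fun a => model_lact a v).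
Proof. by move=> c a b; apply/ffunP=> i; rewrite !ffunE mulrDl -scalerAl. Qed.
Fact model_ract_linear a : linear (fun v => model_ract v a).
Proof. by move=> c u v; apply/ffunP=> i; rewrite !ffunE mulrDl -scalerAl. Qed.
Fact model_ract_linearr v : linear (model_ract v).
Proof. by move=> c a b; apply/ffunP=> i; rewrite !ffunE mulrDr -scalerAr. Qed.
Fact model_lact1 v : model_lact 1 v = v.
Proof. by apply/ffunP=> i; rewrite !ffunE mul1r. Qed.
Fact model_lactM a b v : model_lact (a * b) v = model_lact a (model_lact b v).
Proof. by apply/ffunP=> i; rewrite !ffunE mulrA. Qed.
Fact model_ract1 v : model_ract v 1 = v.
Proof. by apply/ffunP=> i; rewrite !ffunE mulr1. Qed.
Fact model_ractM a b v : model_ract v (a * b) = model_ract (model_ract v a) b.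
Proof. by apply/ffunP=> i; rewrite !ffunE mulrA. Qed.
Fact model_lractA a v b : model_ract (model_lact a v) b = model_lact a (model_ract v b).
Proof. by apply/ffunP=> i; rewrite !ffunE mulrA. Qed.

Definition model_bimodule : bimodule k X :=
  Bimodule model_lact_linear model_lact_linearl model_ract_linear model_ract_linearr
    model_lact1 model_lactM model_ract1 model_ractM model_lractA.

Fact model_diff_linear : linear (model_diff : _ -> model_bimodule).
Proof.
move=> c a b; apply/ffunP=> i; rewrite !ffunE.
by rewrite scalerAr -mulrDr scalerBr opprD addrACA.
Qed.
Fact model_diff_Leibniz a b :
  model_diff (a * b) =
    ract (model_diff a : model_bimodule) b + lact a (model_diff b : model_bimodule).
Proof.
apply/ffunP=> i; rewrite !ffunE [X in _ = _ + X]mulrCA -mulrA -mulrDr; congr (_ * _).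
by rewrite mulrBl mulrBr addrA subrK.
Qed.

Definition model_calculus : calculus k X :=
  @Calculus k X model_bimodule model_diff model_diff_linear model_diff_Leibniz.

Definition model_restr (p : X * X) (w : model_calculus) : {ffun 'I_(D.2 p) -> k^o} :=
  [ffun i => w (Tagged (fun p => 'I_(D.2 p)) i)].

Fact model_restr_linear p : linear (model_restr p).
Proof. by move=> c u v; apply/ffunP=> i; rewrite !ffunE. Qed.
HB.instance Definition _ p := GRing.isLinear.Build k model_calculus _ _ (@model_restr p)
  (@model_restr_linear p).

Lemma model_restr_corner p (w : model_calculus) :
  model_restr p (corner_map p.1 p.2 w) = model_restr p w.
Proof. by apply/ffunP => i; rewrite !ffunE /= !eqxx mul1r mulr1. Qed.

(** Restriction to the coordinates tagged by [p] maps the corner isomorphically onto the functions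
    on ['I_(D.2 p)]. *)
Lemma model_dim p : \dim (corner model_calculus p.1 p.2) = D.2 p.
Proof.
rewrite -(limg_dim_eq (f := linfun (@model_restr p))).
  suff -> : (linfun (@model_restr p) @: corner model_calculus p.1 p.2 = fullv)%VS.
    by rewrite dimvf /dim /= card_ord muln1.
  apply/vspaceP => u; rewrite memvf; apply/memv_imgP.
  (* Surjectivity: extend [u] by zero to the other tags. *)
  pose w : model_calculus := [ffun i => untag 0 (u : _ -> k) i].
  exists (corner_map p.1 p.2 w); first exact: corner_map_corner.
  rewrite lfunE /= model_restr_corner; apply/ffunP => i.
  rewrite [RHS]ffunE [RHS]ffunE.
  symmetry.
  exact: (@untagE _ (fun q => 'I_(D.2 q)) k 0 p u (Tagged (fun q => 'I_(D.2 q)) i) erefl).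
(* Injectivity: an element of the corner vanishes at all other tags. *)
apply/eqP; rewrite -subv0; apply/subvP => w; rewrite memv_cap memv_ker memv0.
case/andP=> wp; rewrite lfunE /= => /eqP w0; apply/eqP/ffunP => i.
move: wp => /mem_cornerP[u uw]; rewrite uw !ffunE.
have [h1|_] := eqVneq (tag i).1 p.1; last by rewrite mul0r.
have [h2|_] := eqVneq (tag i).2 p.2; last by rewrite mulr0 mulr0.
have {h1 h2} h : tag i = p by apply/eqP; rewrite -pair_eqE /pair_eq h1 h2 !eqxx.
case: i h => q i /= h; subst q.
by move/ffunP/(_ i): w0; rewrite uw !ffunE /= !eqxx.
Qed.

Lemma model_calculus_data : admissible D -> calc_data model_calculus = D.
Proof.
move=> Dadm; rewrite [RHS]surjective_pairing; congr pair; last first.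
  by apply/ffunP => p; rewrite ffunE model_dim.
apply: digraph_inj; apply/setP => -[x y]; rewrite inE /=.
apply/andP/idP => [[xy]|xyD].
  apply: contraR => xyD; apply/eqP/ffunP => i; rewrite !ffunE.
  have [h1|_] := eqVneq (tag i).1 x; last by rewrite mul0r.
  have [h2|_] := eqVneq (tag i).2 y; last by rewrite h1 (negPf xy) subrr !mulr0.
  have txy : tag i = (x, y) by apply/eqP; rewrite -pair_eqE /pair_eq h1 h2 !eqxx.
  by rewrite [tag i \in _](_ : _ = false) ?mul0r ?mulr0 // txy (negPf xyD).
have /= xy := arrow_neq xyD; split=> //; apply/eqP.
(* Admissibility, read as [0 < D.2 (x, y)], makes 0 a valid index; at this marked coordinate the
   form takes the value 1. *)
move/ffunP/(_ (Tagged (fun p => 'I_(D.2 p)) (Ordinal (Dadm _ _ xyD)))).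
rewrite !ffunE /= xyD !eqxx (negPf xy) !mul1r subr0 => /eqP.
by rewrite oner_eq0.
Qed.

End Model.

Theorem corollary2p2 (k : fieldType) (X : finType) :
  [/\ forall C : calculus k X, admissible (calc_data C),
      forall C C' : calculus k X, calc_iso C C' <-> calc_data C = calc_data C',
      forall D : digraph X * {ffun X * X -> nat},
        admissible D -> exists C : calculus k X, calc_data C = D
    & forall C : calculus k X,
        [/\ is_standard (std_subcalculus C),
            calc_digraph (std_subcalculus C) = calc_digraph C
          & calc_iso (std_subcalculus C) (digraph_calculus k (calc_digraph C))]].
Proof.
split=> [C|C C'|D Dadm|C].
- exact: calc_data_admissible.
- by split; [exact: calc_iso_data | exact: calc_data_iso].
- by exists (model_calculus k D); apply: model_calculus_data.
split; [exact: std_subcalculus_standard | exact: std_subcalculus_digraph |].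
(* Both calculi are standard, so their corner dimensions are determined by their digraphs, which are
   all that remains to compare. *)
apply/calc_data_iso/standard_data_inj.
- exact: std_subcalculus_standard.
- exact: digraph_calculus_standard.
- by rewrite std_subcalculus_digraph digraph_calculus_digraph.
Qed.
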